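(* Let $G$ be a simple undirected graph. Then $G$ is a central max-point-tolerance graph if and only if there exists a central interval catch digraph $D$ such that $G=D\cap D^{T}$, where $D^{T}$ is the digraph obtained from $D$ by reversing the direction of every arc.
   Context: Graphs and digraphs are finite and simple (no loops, no multiple edges/arcs); intervals are closed bounded intervals of the real line. A graph $G=(V,E)$ is a central max-point-tolerance graph (central MPTG) if one can assign to each $u\in V$ an interval $I_u$ with center (midpoint) $c_u$ such that for distinct $u,v\in V$: $uv\in E$ if and only if $\{c_u,c_v\}\subseteq I_u\cap I_v$. A digraph $D=(V,A)$ is a central interval catch digraph (central ICD) if one can assign to each $u\in V$ an interval $I_u$ with center (midpoint) $c_u$ such that for $u,v\in V$: $uv\in A$ if and only if $u\ne v$ and $c_v\in I_u$. $D\cap D^T$ is the undirected graph on the vertex set of $D$ in which $u$ and $v$ are adjacent if and only if both $uv$ and $vu$ are arcs of $D$. *)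

(* Defs.v *)
From mathcomp Require Import all_boot all_order all_algebra.
From mathcomp Require Import all_classical all_reals.

Set Implicit Arguments.
Unset Strict Implicit.
Unset Printing Implicit Defensive.

Import Order.TTheory GRing.Theory Num.Theory.
Local Open Scope ring_scope.
Local Open Scope classical_set_scope.

Record sgraph (V : finType) := SGraph {
  adj :> rel V;
  adj_sym : symmetric adj;
  adj_irr : irreflexive adj
}.

Record digraph (V : finType) := Digraph {
  arc :> rel V;
  arc_irr : irreflexive arc
}.

Lemma dtranspose_irr (V : finType) (D : digraph V) :
  irreflexive [rel u v | arc D v u].
Proof. exact: (@arc_irr V D). Qed.

Definition dtranspose (V : finType) (D : digraph V) : digraph V :=
  Digraph (dtranspose_irr D).

Lemma capT_sym (V : finType) (D : digraph V) :
  symmetric [rel u v | D u v && dtranspose D u v].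
Proof. by move=> u v /=; rewrite andbC. Qed.

Lemma capT_irr (V : finType) (D : digraph V) :
  irreflexive [rel u v | D u v && dtranspose D u v].
Proof. by move=> u /=; rewrite arc_irr. Qed.

Definition capT (V : finType) (D : digraph V) : sgraph V :=
  SGraph (@capT_sym V D) (@capT_irr V D).

(* Nonempty closed bounded intervals; single points are allowed. *)
Record cbitv (R : realType) := CBItv {
  left_end : R;
  right_end : R;
  ends_le : left_end <= right_end
}.

Definition cbset (R : realType) (I : cbitv R) : set R :=
  `[left_end I, right_end I]%classic.

Definition center (R : realType) (I : cbitv R) : R :=
  (left_end I + right_end I) / 2.

Definition central_MPTG (R : realType) (V : finType) (G : sgraph V) : Prop :=
  exists I : V -> cbitv R, forall u v : V, u != v ->
    (G u v <->
     [set center (I u); center (I v)] `<=` cbset (I u) `&` cbset (I v)).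

Definition central_ICD (R : realType) (V : finType) (D : digraph V) : Prop :=
  exists I : V -> cbitv R, forall u v : V,
    D u v <-> (u <> v /\ cbset (I u) (center (I v))).

(* Main.v *)
Require Import Defs.
From mathcomp Require Import all_boot all_order all_algebra.
From mathcomp Require Import all_classical all_reals.

Import Num.Theory.

(** One and the same family of intervals serves both representations. An interval contains its own
    midpoint, so of the four memberships in $\{c_u,c_v\}\subseteq I_u\cap I_v$ only $c_v\in I_u$ and
    $c_u\in I_v$ carry information ([centers_sub_cap]). For $u\ne v$ these say exactly that $uv$ and
    $vu$ are both arcs of the catch digraph of the family. *)

Lemma center_in_cbset (R : realType) (I : cbitv R) : cbset I (center I).
Proof.
by case: I => a b ab; rewrite /cbset /center /= in_itv /= !midf_le.
Qed.

Lemma centers_sub_cap (R : realType) (I J : cbitv R) :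
  ([set center I; center J] `<=` cbset I `&` cbset J)%classic <->
  cbset I (center J) /\ cbset J (center I).
Proof.
split=> [sub|[IJ JI] x [|] ->]; last 2 first.
- by split=> //; exact: center_in_cbset.
- by split=> //; exact: center_in_cbset.
have [_ JI] := sub _ (or_introl erefl).
by have [IJ _] := sub _ (or_intror erefl).
Qed.

(** The disequality excludes the loops that would otherwise arise at every vertex, as each interval
    catches its own center. Membership in a real interval is a proposition, hence the classical
    reflection into [bool]. *)
Definition catch_rel (R : realType) (V : finType) (I : V -> cbitv R) : rel V :=
  fun u v => (u != v) && `[< cbset (I u) (center (I v)) >].

Lemma catch_rel_irr (R : realType) (V : finType) (I : V -> cbitv R) :
  irreflexive (catch_rel R V I).
Proof. by move=> u; rewrite /catch_rel eqxx. Qed.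

Lemma catch_relP (R : realType) (V : finType) (I : V -> cbitv R) (u v : V) :
  catch_rel R V I u v <-> u <> v /\ cbset (I u) (center (I v)).
Proof.
by split=> [/andP[/eqP ? /asboolP]|[/eqP ? ?]] //; apply/andP; split=> //;
  apply/asboolP.
Qed.

Theorem proposition3p13 (R : realType) (V : finType) (G : sgraph V) :
  central_MPTG R G <->
  exists D : digraph V, central_ICD R D /\ adj G =2 adj (capT D).
Proof.
split=> [[I GI]|[D [[I DI] GD]]].
  exists (Digraph (catch_rel_irr R V I)); split.
    by exists I => u v; exact: catch_relP.
  (* The hypothesis [GI] covers distinct vertices only; on the diagonal both graphs agree because
     neither has loops. *)
  move=> u v; have [<-|uv] := eqVneq u v; first by rewrite !adj_irr.
  apply/idP/andP => /= [/(GI _ _ uv)/centers_sub_cap[Iuv Ivu]|].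
    by split; apply/catch_relP; split=> //; apply/eqP; rewrite // eq_sym.
  move=> [/catch_relP[_ Iuv] /catch_relP[_ Ivu]].
  by apply/(GI _ _ uv)/centers_sub_cap.
(* Conversely, the intervals that represent [D] are kept for [G]. *)
exists I => u v /eqP uv; rewrite GD; split=> [/andP[/= /DI[_ Iuv] /DI[_ Ivu]]|].
  exact/centers_sub_cap.
move=> /centers_sub_cap[Iuv Ivu]; apply/andP; split=> /=; apply/DI; split=> //.
exact: nesym.
Qed.
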